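(* Let $n\ge1$, $a\ge0$, $d\ge2$, $1\le e\le d-1$ and $s\ge1$ be integers, and let $\mathbf n=(n,n+a,1)$, $\mathbf d=(1,1,d)$. Suppose that $$\max\{(n+1)(d-e)+1,\ (n+a+1)e+1\}\le s,$$ $$n\ \ge\ (n+1)(d-e+1)-s\ >\ 0,\qquad n+a\ \ge\ (n+a+1)(e+1)-s\ >\ 0.$$ Then $\sigma_s(X_{\mathbf n,\mathbf d})$ is defective. (These are exactly conditions (C0) and (C1) of the general setup for $\mathbf e_0=(1,0,d-e)$, $\mathbf e_1=(0,1,e)$.)
   Context: $K$ is an algebraically closed field of characteristic $0$. For $\mathbf n=(n_0,\dots,n_{k-1})$, $\mathbf d=(d_0,\dots,d_{k-1})$ positive integer tuples, $N(\mathbf n,\mathbf d)=\prod_i\binom{n_i+d_i}{d_i}$ and $D(\mathbf n)=\sum_in_i$. With $V_i$ a $K$-vector space of dimension $n_i+1$, the Segre–Veronese variety $X_{\mathbf n,\mathbf d}\subset\mathbb P(\bigotimes_i\mathrm{Sym}_{d_i}V_i)$ is the image of $\prod_i\mathbb PV_i$ under $([u_i])_i\mapsto[u_0^{d_0}\otimes\cdots\otimes u_{k-1}^{d_{k-1}}]$. $\sigma_s(X)$ is the Zariski closure of the union of linear spans of $s$ linearly independent points of $X$; it is defective if $\dim\sigma_s(X_{\mathbf n,\mathbf d})<\min\{s(D(\mathbf n)+1),N(\mathbf n,\mathbf d)\}-1$. *)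

(* Defs.v *)
From HB Require Import structures.
From mathcomp Require Import all_boot all_order all_algebra.
Set Implicit Arguments. Unset Strict Implicit. Unset Printing Implicit Defensive.
Import GRing.Theory Num.Theory.
Local Open Scope ring_scope.

Section Zariski.
Variables (K : fieldType) (I : Type).

Definition pt := I -> K.

Inductive polyfun : (pt -> K) -> Prop :=
| pf_const (c : K) : polyfun (fun _ => c)
| pf_var (i : I) : polyfun (fun x => x i)
| pf_add f g : polyfun f -> polyfun g -> polyfun (fun x => f x + g x)
| pf_mul f g : polyfun f -> polyfun g -> polyfun (fun x => f x * g x).

Definition zclosed (Z : pt -> Prop) : Prop :=
  exists F : (pt -> K) -> Prop,
    (forall f, F f -> polyfun f) /\ (forall x, Z x <-> (forall f, F f -> f x = 0)).

Definition zclosure (S : pt -> Prop) : pt -> Prop :=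
  fun x => forall Z, zclosed Z -> (forall y, S y -> Z y) -> Z x.

Definition zirreducible (Z : pt -> Prop) : Prop :=
  [/\ zclosed Z, exists x, Z x &
      forall Z1 Z2, zclosed Z1 -> zclosed Z2 ->
        (forall x, Z x -> Z1 x \/ Z2 x) ->
        (forall x, Z x -> Z1 x) \/ (forall x, Z x -> Z2 x)].

Definition has_chain (S : pt -> Prop) (m : nat) : Prop :=
  exists C : nat -> pt -> Prop,
    (forall t, (t <= m)%N -> zirreducible (C t) /\ (forall x, C t x -> S x)) /\
    (forall t, (t < m)%N ->
       (forall x, C t x -> C t.+1 x) /\ exists x, C t.+1 x /\ ~ C t x).

Definition krull_dim (S : pt -> Prop) (m : nat) : Prop :=
  has_chain S m /\ ~ has_chain S m.+1.

End Zariski.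

(* The ambient space (x)_i Sym_{d_i} V_i is viewed (char 0) inside
   (x)_i V_i^{(x) d_i}, whose coordinates are indexed by
   j = (j_i)_i with j_i : 'I_(d_i) -> 'I_(n_i + 1). *)
Definition SVidx (k : nat) (nv dv : 'I_k -> nat) :=
  {dffun forall i : 'I_k, {ffun 'I_(dv i) -> 'I_(nv i).+1}}.

Section SegreVeronese.
Variables (K : fieldType) (k : nat) (nv dv : 'I_k -> nat).

Local Notation idx := (SVidx nv dv).

(* u_0^{d_0} (x) ... (x) u_{k-1}^{d_{k-1}} *)
Definition sv_point (u : forall i : 'I_k, 'I_(nv i).+1 -> K) : pt K idx :=
  fun j => \prod_(i < k) \prod_(t < dv i) u i (j i t).

Definition sv_cone (x : pt K idx) : Prop :=
  exists u : forall i : 'I_k, 'I_(nv i).+1 -> K,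
    (forall i, exists c, u i c != 0) /\ x = sv_point u.

Definition lin_indep (s : nat) (v : 'I_s -> pt K idx) : Prop :=
  forall lam : 'I_s -> K,
    (forall j, \sum_(t < s) lam t * v t j = 0) -> forall t, lam t = 0.

Definition secant_union (s : nat) (x : pt K idx) : Prop :=
  exists v : 'I_s -> pt K idx,
    [/\ forall t, sv_cone (v t), lin_indep v &
        exists lam : 'I_s -> K, x = fun j => \sum_(t < s) lam t * v t j].

Definition sigma_cone (s : nat) : pt K idx -> Prop := zclosure (secant_union s).

Definition Ncount : nat := \prod_(i < k) 'C(nv i + dv i, dv i).
Definition Dsum : nat := \sum_(i < k) nv i.

(* sigma_s(X) is defective: projective dimension (= affine cone dim - 1)
   is < min{s(D+1), N} - 1 *)
Definition sv_defective (s : nat) : Prop :=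
  exists m : nat, krull_dim (sigma_cone s) m /\
    (Posz m - 1 < Posz (minn (s * (Dsum.+1)) Ncount) - 1)%R.

End SegreVeronese.

Definition tri (x0 x1 x2 : nat) : 'I_3 -> nat := fun i => nth 0%N [:: x0; x1; x2] i.

(* Main.v *)
Require Import Defs.
From HB Require Import structures.
From Stdlib Require Import Classical IndefiniteDescription FunctionalExtensionality.
From mathcomp Require Import all_boot all_order all_algebra.
From mathcomp Require Import zify.
Set Implicit Arguments. Unset Strict Implicit. Unset Printing Implicit Defensive.
Import GRing.Theory Num.Theory.
Local Open Scope ring_scope.

(** Write alpha = n+1, beta = n+a+1. A sum of s terms a_t (x) b_t (x) c_t^d has a
    flattening of size alpha(d-e+1) x beta(e+1) and rank at most s, where
    alpha(d-e+1) = s + h0, beta(e+1) = s + h1, 1 <= h0 <= n and 1 <= h1 <= n+a.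
    Choose h0 indices i and h1 indices j. The entries in the rows (i, 0) and columns
    (j, 0) are the coordinates T_(i,j,0), which occur nowhere else in the flattening,
    so expanding the bordered (s+1)-minors shows that each of them is a rational
    function of the other coordinates, with denominator the complementary s-minor;
    that minor is generically nonzero by a Vandermonde computation. Hence the cone
    over sigma_s has dimension at most N - h0 h1 = s(D+1) - (alpha-h0)(beta-h1),
    which is below both N and s(D+1).

    The dimension bound is elementary: a chain of m+1 irreducible closed sets yields
    m functions algebraically independent on the largest one, and m algebraically
    independent rational functions in p variables force m <= p by counting monomials. *)

(** * Polynomial functions *)

Section PolynomialFunctions.
Variables (K : fieldType) (I : Type).
Implicit Types (f g : pt K I -> K).

Lemma polyfun_ext f g : f =1 g -> polyfun f -> polyfun g.
Proof. by move=> /functional_extensionality ->. Qed.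

Lemma pt_eq f (x y : pt K I) : x =1 y -> f x = f y.
Proof. by move=> /functional_extensionality ->. Qed.

Lemma polyfun_sum (T : Type) (r : seq T) (F : T -> pt K I -> K) :
  (forall t, polyfun (F t)) -> polyfun (fun x => \sum_(t <- r) F t x).
Proof.
move=> pF; elim: r => [|t r IH].
  by apply: polyfun_ext (pf_const I (0 : K)) => x; rewrite big_nil.
by apply: polyfun_ext (pf_add (pF t) IH) => x; rewrite big_cons.
Qed.

Lemma polyfun_prod (T : Type) (r : seq T) (F : T -> pt K I -> K) :
  (forall t, polyfun (F t)) -> polyfun (fun x => \prod_(t <- r) F t x).
Proof.
move=> pF; elim: r => [|t r IH].
  by apply: polyfun_ext (pf_const I (1 : K)) => x; rewrite big_nil.
by apply: polyfun_ext (pf_mul (pF t) IH) => x; rewrite big_cons.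
Qed.

Lemma polyfun_exp f n : polyfun f -> polyfun (fun x => f x ^+ n).
Proof.
move=> pf; elim: n => [|n IH].
  by apply: polyfun_ext (pf_const I (1 : K)) => x; rewrite expr0.
by apply: polyfun_ext (pf_mul pf IH) => x; rewrite exprS.
Qed.

Lemma polyfun_det n (M : pt K I -> 'M[K]_n) :
  (forall i j, polyfun (fun x => M x i j)) -> polyfun (fun x => \det (M x)).
Proof.
move=> pM; apply: polyfun_sum => s; apply: pf_mul; first exact: pf_const.
by apply: polyfun_prod => i; apply: pM.
Qed.

Lemma polyfun_line f (x y : pt K I) : polyfun f ->
  exists p : {poly K}, forall t, f (fun i => x i + t * (y i - x i)) = p.[t].
Proof.
elim=> [c|i|f1 g1 _ [p pE] _ [q qE]|f1 g1 _ [p pE] _ [q qE]].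
- by exists c%:P => t; rewrite hornerC.
- exists ((x i)%:P + 'X * (y i - x i)%:P) => t.
  by rewrite hornerD hornerM !hornerC hornerX.
- by exists (p + q) => t; rewrite hornerD pE qE.
- by exists (p * q) => t; rewrite hornerM pE qE.
Qed.

Hypothesis charK : [pchar K] =i pred0.

Lemma natr_inj : injective (fun n : nat => n%:R : K).
Proof.
move=> i j /eqP; wlog le_ij : i j / (i <= j)%N => [H|].
  by case: (leqP i j) => [/H//|/ltnW/H]; rewrite eq_sym => H' /H' ->.
rewrite eq_sym -subr_eq0 -natrB // (pcharf0P _).1 // subn_eq0 => le_ji.
by apply/eqP; rewrite eqn_leq le_ij.
Qed.

Lemma poly_nonroot (p : {poly K}) : p != 0 -> exists t, p.[t] != 0.
Proof.
move=> nz; have : has (fun t => ~~ root p t) [seq n%:R | n <- iota 0 (size p)].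
  rewrite -[has _ _]negbK -all_predC; apply/negP => H.
  have /max_poly_roots : p != 0 by [].
  move/(_ [seq n%:R | n <- iota 0 (size p)]).
  rewrite (map_inj_uniq natr_inj) iota_uniq size_map size_iota ltnn => H'.
  suff: false by []; apply: H' => //.
  by apply/allP => t /(allP H) /=; rewrite negbK.
by move=> /hasP[t _ ?]; exists t.
Qed.

(** Join a point where [f] is nonzero to one where [g] is nonzero. Along this line both restrict to
    nonzero univariate polynomials, and in characteristic 0 their product has a nonroot among the
    values [n%:R]. *)
Lemma polyfun_domain f g : polyfun f -> polyfun g ->
  (forall x, f x * g x = 0) -> (exists x, g x != 0) -> forall x, f x = 0.
Proof.
move=> pf pg fg0 [y gy] x; apply/eqP/negPn/negP => fx.
have [p pE] := polyfun_line x y pf; have [q qE] := polyfun_line x y pg.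
have p0 : p != 0.
  apply: contraNneq fx => p0; move: (pE 0); rewrite p0 horner0 => <-.
  by apply/eqP/pt_eq => i; rewrite mul0r addr0.
have q0 : q != 0.
  apply: contraNneq gy => q0; move: (qE 1); rewrite q0 horner0 => <-.
  by apply/eqP/pt_eq => i; rewrite mul1r addrC subrK.
have [t] := poly_nonroot (mulf_neq0 p0 q0).
by rewrite hornerM -pE -qE fg0 eqxx.
Qed.

End PolynomialFunctions.

Lemma polyfun_comp (K : fieldType) (I Q : Type) (f : pt K I -> K)
    (u : pt K Q -> pt K I) :
  polyfun f -> (forall i, polyfun (fun x => u x i)) -> polyfun (fun x => f (u x)).
Proof.
move=> pf pu; elim: pf => [c|i|f1 g1 _ ? _ ?|f1 g1 _ ? _ ?].
- exact: pf_const.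
- exact: pu.
- exact: pf_add.
- exact: pf_mul.
Qed.

(** * Linear dependence among functions of bounded degree *)

Section BoundedDegree.
Variables (K : fieldType) (J : finType).
Implicit Types (f g : pt K J -> K).

(* The bound is on the degree in each variable separately, so that the
   monomials allowed are indexed by a plain function type. *)
Definition bdeg (B : nat) f : Prop :=
  exists c : {ffun J -> 'I_B.+1} -> K,
    forall y, f y = \sum_k c k * \prod_j y j ^+ k j.

Lemma bdeg_ext B f g : f =1 g -> bdeg B f -> bdeg B g.
Proof. by move=> fg [c cE]; exists c => y; rewrite -fg cE. Qed.

Lemma bdeg_monomial B (c : K) (m : J -> nat) : (forall j, (m j <= B)%N) ->
  bdeg B (fun y => c * \prod_j y j ^+ m j).
Proof.
move=> mB; pose k0 := [ffun j => inord (m j)] : {ffun J -> 'I_B.+1}.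
exists (fun k => if k == k0 then c else 0) => y.
rewrite (bigD1 k0) //= eqxx [X in _ + X]big1 ?addr0 => [|k /negbTE ->]; last first.
  by rewrite mul0r.
by congr (_ * _); apply: eq_bigr => j _; rewrite ffunE inordK // ltnS.
Qed.

Lemma bdeg_sum (T : finType) B (F : T -> pt K J -> K) :
  (forall t, bdeg B (F t)) -> bdeg B (fun y => \sum_t F t y).
Proof.
move=> /fin_all_exists[c cE]; exists (fun k => \sum_t c t k) => y.
under eq_bigr do rewrite cE.
by rewrite exchange_big; apply: eq_bigr => k _; rewrite mulr_suml.
Qed.

Lemma bdeg_leq B B' f : (B <= B')%N -> bdeg B f -> bdeg B' f.
Proof.
move=> le_B [c cE]; apply: bdeg_ext (fun y => esym (cE y)) _.
apply: bdeg_sum => k; apply: bdeg_monomial => j.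
by apply: leq_trans le_B; rewrite -ltnS.
Qed.

Lemma bdeg_mul B B' f g :
  bdeg B f -> bdeg B' g -> bdeg (B + B') (fun y => f y * g y).
Proof.
move=> [c cE] [c' cE'].
pose F (kl : {ffun J -> 'I_B.+1} * {ffun J -> 'I_B'.+1}) (y : pt K J) :=
  c kl.1 * c' kl.2 * \prod_j y j ^+ (kl.1 j + kl.2 j).
apply: (@bdeg_ext _ (fun y => \sum_kl F kl y)) => [y|].
  rewrite cE cE' mulr_suml -(pair_bigA _ (fun k l => F (k, l) y)) /=.
  apply: eq_bigr => k _; rewrite mulr_sumr; apply: eq_bigr => l _.
  rewrite /F /= mulrACA; congr (_ * _).
  by rewrite -big_split; apply: eq_bigr => j _; rewrite exprD.
apply: bdeg_sum => -[k l]; apply: bdeg_monomial => j /=.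
by rewrite leq_add // -ltnS.
Qed.

Lemma bdeg_const (c : K) : bdeg 0 (fun _ => c).
Proof.
apply: bdeg_ext (@bdeg_monomial 0 c (fun _ => 0%N) _) => // y.
by rewrite big1 ?mulr1 // => j _; rewrite expr0.
Qed.

Lemma bdeg_exp B f n : bdeg B f -> bdeg (B * n) (fun y => f y ^+ n).
Proof.
move=> bf; elim: n => [|n IH].
  by rewrite muln0; apply: bdeg_ext (bdeg_const 1) => y; rewrite expr0.
by rewrite mulnS; apply: bdeg_ext (bdeg_mul bf IH) => y; rewrite exprS.
Qed.

Lemma polyfun_bdeg f : polyfun f -> exists B, bdeg B f.
Proof.
elim=> [c|j|f1 g1 _ [B bf] _ [C bg]|f1 g1 _ [B bf] _ [C bg]].
- by exists 0%N; apply: bdeg_const.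
- exists 1%N; apply: bdeg_ext (@bdeg_monomial 1 1 (fun i => i == j : nat) _) => [y|i].
    rewrite mul1r (bigD1 j) //= eqxx expr1 big1 ?mulr1 // => i /negbTE ->.
    by rewrite expr0.
  by case: (i == j).
- exists (maxn B C); pose F (b : bool) := if b then f1 else g1.
  apply: bdeg_ext (@bdeg_sum bool _ F _) => [y|]; first by rewrite big_bool.
  by case; [apply: bdeg_leq bf|apply: bdeg_leq bg]; rewrite ?leq_maxl ?leq_maxr.
- by exists (B + C)%N; apply: bdeg_mul.
Qed.

(** The coefficient matrix has [#|T|] rows and only [B.+1 ^ #|J|] columns, one for each admissible
    monomial, so it has a nonzero left kernel vector. *)
Lemma bdeg_dependent (T : finType) B (F : T -> pt K J -> K) :
  (forall t, bdeg B (F t)) -> (B.+1 ^ #|J| < #|T|)%N ->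
  exists c : T -> K, (exists t, c t != 0) /\ forall y, \sum_t c t * F t y = 0.
Proof.
move=> /fin_all_exists[a aE] ltT.
pose X := {ffun J -> 'I_B.+1}.
pose A : 'M[K]_(#|T|, #|X|) := \matrix_(i, k) a (enum_val i) (enum_val k).
have kA : kermx A != 0.
  rewrite kermx_eq0 /row_free neq_ltn (leq_ltn_trans (rank_leq_col A)) //.
  by rewrite /X card_ffun card_ord.
pose v := nz_row (kermx A).
have v0 : v != 0 by rewrite nz_row_eq0.
have vA : v *m A = 0 by apply/sub_kermxP; apply: nz_row_sub.
exists (fun t => v 0 (enum_rank t)); split.
  have [i vi] := rV0Pn _ v0.
  by exists (enum_val i); rewrite enum_valK.
move=> y; under eq_bigr do rewrite aE mulr_sumr.
rewrite exchange_big big1 // => k _.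
under eq_bigr do rewrite mulrA.
rewrite -mulr_suml.
have /matrixP/(_ 0 (enum_rank k)) := vA.
rewrite !mxE (reindex (@enum_rank T)) /=; last first.
  by exists enum_val => ? _; [apply: enum_rankK|apply: enum_valK].
under eq_bigr do rewrite mxE !enum_rankK.
by move=> ->; rewrite mul0r.
Qed.

End BoundedDegree.

(** * Chains of irreducible closed sets *)

Section Monomials.
Variable D : nat.

(** Exponent vectors of length [m] with entries below [D]. The recursion splits off the exponent of
    the last function, matching the induction along a chain, which removes the top member. *)
Fixpoint midx (m : nat) : finType :=
  if m is m'.+1 then ('I_D * midx m')%type else unit.

Fixpoint mono (K : fieldType) (X : Type) (f : nat -> X -> K) (m : nat) :
    midx m -> X -> K :=
  match m with
  | 0 => fun _ _ => 1
  | m'.+1 => fun k x => f m' x ^+ k.1 * mono f k.2 x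
  end.

Lemma card_midx m : #|midx m| = (D ^ m)%N.
Proof. by elim: m => [|m IH]; rewrite ?card_unit //= card_prod card_ord IH expnS. Qed.

Lemma polyfun_mono (K : fieldType) (I : Type) (f : nat -> pt K I -> K) m k :
  (forall t, (t < m)%N -> polyfun (f t)) -> polyfun (@mono K _ f m k).
Proof.
elim: m k => [|m IH] k pf /=; first exact: pf_const.
apply: pf_mul; first by apply: polyfun_exp; apply: pf.
by apply: IH => t /ltnW/pf.
Qed.

End Monomials.

Section Chains.
Variables (K : fieldType) (I : Type).
Implicit Types (Z : pt K I -> Prop) (f : pt K I -> K).

Lemma zclosed_zero f : polyfun f -> zclosed (fun x => f x = 0).
Proof.
move=> pf; exists (eq f); split=> [_ <-//|x].
by split=> [fx _ <-//|/(_ f erefl)].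
Qed.

(** The zero sets of [f] and [g] are closed and together cover [Z], so one of them contains [Z]; the
    given point excludes the first. *)
Lemma zirreducible_domain Z f g : zirreducible Z -> polyfun f -> polyfun g ->
  (forall x, Z x -> f x * g x = 0) -> (exists x, Z x /\ f x <> 0) ->
  forall x, Z x -> g x = 0.
Proof.
move=> [_ _ irrZ] pf pg fg0 [x0 [Zx0 fx0]].
case: (irrZ _ _ (zclosed_zero pf) (zclosed_zero pg)) => [x /fg0 /eqP|/(_ _ Zx0)//|//].
by rewrite mulf_eq0 => /orP[]/eqP; [left|right].
Qed.

Lemma zclosure_zero (S : pt K I -> Prop) f : polyfun f ->
  (forall x, S x -> f x = 0) -> forall x, zclosure S x -> f x = 0.
Proof. by move=> pf f0 x /(_ _ (zclosed_zero pf) f0). Qed.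

(* A relation among f_0, .., f_m on C_(m+1) is divisible by f_m, since its
   restriction to C_m, where f_m vanishes, is a relation among f_0, .., f_(m-1). *)
Lemma chain_independent (D m : nat) (C : nat -> pt K I -> Prop)
    (f : nat -> pt K I -> K) :
  (forall t, (t <= m)%N -> zirreducible (C t)) ->
  (forall t, (t < m)%N -> forall x, C t x -> C t.+1 x) ->
  (forall t, (t < m)%N -> [/\ polyfun (f t), forall x, C t x -> f t x = 0
                            & exists x, C t.+1 x /\ f t x <> 0]) ->
  forall c : midx D m -> K,
  (forall x, C m x -> \sum_k c k * mono f k x = 0) -> forall k, c k = 0.
Proof.
elim: m => [|m IH] irrC subC fC c c0 k.
  have [_ [x Cx] _] := irrC 0%N isT.
  by have := c0 x Cx; rewrite (bigD1 k) //= big1 ?addr0 ?mulr1 // => -[] /eqP; case: k.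
have {}IH := IH (fun t h => irrC t (leqW h)) (fun t h => subC t (leqW h))
               (fun t h => fC t (leqW h)).
have [pfm fm0 fmn0] := fC m (ltnSn m).
have pmono k' : polyfun (@mono D K _ f m k').
  by apply: polyfun_mono => t /leqW/fC[].
pose G (c' : midx D m -> K) x := \sum_k' c' k' * mono f k' x.
have pG c' : polyfun (G c').
  by apply: polyfun_sum => k'; apply: pf_mul; [apply: pf_const|apply: pmono].
(* The number [E] of powers of [f m] is freed from [D], so that dividing the relation by [f m] gives
   a shorter instance of the same claim. *)
have key E (c' : nat -> midx D m -> K) :
    (forall x, C m.+1 x -> \sum_(j < E) f m x ^+ j * G (c' j) x = 0) ->
    forall j, (j < E)%N -> forall k', c' j k' = 0.
  elim: E c' => [//|E IHE] c' Hc'.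
  have c00 : forall k', c' 0%N k' = 0.
    apply: IH => x Cx; have := Hc' x (subC _ (ltnSn m) _ Cx).
    rewrite big_ord_recl big1 => [|j _]; first by rewrite expr0 mul1r addr0.
    by rewrite fm0 // expr0n mul0r.
  have G00 x : G (c' 0%N) x = 0 by apply: big1 => k' _; rewrite c00 mul0r.
  case=> [_ //|j] ltj; apply: (IHE (fun j => c' j.+1)) ltj.
  pose H x := \sum_(i < E) f m x ^+ i * G (c' i.+1) x.
  apply: (@zirreducible_domain _ _ H (irrC _ (leqnn _)) pfm _ _ fmn0).
    by apply: polyfun_sum => i; apply: pf_mul; [apply: polyfun_exp|apply: pG].
  move=> x Cx; have := Hc' x Cx; rewrite big_ord_recl G00 mulr0 add0r => <-.
  by rewrite mulr_sumr; apply: eq_bigr => i _; rewrite mulrA -exprS.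
case: k => j k.
(* Extending the coefficients by 0 to all natural exponents turns the shift in [key] into a plain
   successor. *)
pose c' (j : nat) k := if insub j is Some j' then c (j', k) else 0.
have c'E (i : 'I_D) k' : c' i k' = c (i, k') by rewrite /c' valK.
rewrite -c'E; apply: (key D) => // x /c0.
have -> : \sum_k c k * mono f k x =
    \sum_(i < D) \sum_(k : midx D m) c (i, k) * (f m x ^+ i * mono f k x).
  by rewrite pair_bigA; apply: eq_bigr => -[].
move=> e0; rewrite -[RHS]e0; apply: eq_bigr => i _.
rewrite mulr_sumr; apply: eq_bigr => k1 _.
by rewrite c'E mulrCA.
Qed.

Lemma chain_separators m (C : nat -> pt K I -> Prop) :
  (forall t, (t <= m)%N -> zirreducible (C t)) ->
  (forall t, (t < m)%N -> exists x, C t.+1 x /\ ~ C t x) ->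
  exists f : nat -> pt K I -> K, forall t, (t < m)%N ->
    [/\ polyfun (f t), forall x, C t x -> f t x = 0
      & exists x, C t.+1 x /\ f t x <> 0].
Proof.
move=> irrC sepC.
(* The guard [t < m] is part of the relation, so that choice applies to every [t], with a dummy
   function beyond the chain. *)
pose R t (f : pt K I -> K) := (t < m)%N -> [/\ polyfun f, forall x, C t x -> f x = 0
  & exists x, C t.+1 x /\ f x <> 0].
apply: (functional_choice R) => t; rewrite /R.
have [lt_tm|] := boolP (t < m)%N; last by exists (fun _ => 0).
have [[F [pF CE]] _ _] := irrC t (ltnW lt_tm).
have [x [Cx nCx]] := sepC t lt_tm.
have : exists f, F f /\ f x <> 0.
  apply: NNPP => nex; apply: nCx; apply/CE => f Ff; apply: NNPP => fx.
  by apply: nex; exists f.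
case=> f [Ff fx]; exists f => _; split; [exact: pF| |by exists x].
by move=> z /CE/(_ f Ff).
Qed.

End Chains.

Lemma uniform_bound m (P : nat -> nat -> Prop) :
  (forall t b b', (b <= b')%N -> P t b -> P t b') ->
  (forall t, (t < m)%N -> exists b, P t b) ->
  exists b, forall t, (t < m)%N -> P t b.
Proof.
move=> mon; elim: m => [|m IH] exP; first by exists 0%N.
have [b Pb] := IH (fun t h => exP t (leqW h)); have [b' Pb'] := exP m (ltnSn m).
exists (maxn b b') => t; rewrite ltnS leq_eqVlt => /orP[/eqP ->|/Pb].
  by apply: mon Pb'; rewrite leq_maxr.
by apply: mon; rewrite leq_maxl.
Qed.

(** * Dimension bound from a rational parametrization *)

Section ChainBound.
Variables (K : fieldType) (I Q : Type) (J : finType) (S : pt K I -> Prop).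
Variables (Phi : pt K Q -> pt K I) (y : pt K Q -> pt K J) (g : pt K J -> K).
Hypothesis charK : [pchar K] =i pred0.
Hypothesis Phi_poly : forall i, polyfun (fun x => Phi x i).
Hypothesis y_poly : forall j, polyfun (fun x => y x j).
Hypothesis g_poly : polyfun g.
Hypothesis g_neq0 : exists x, g (y x) != 0.
Hypothesis Phi_rational :
  forall i, exists h, polyfun h /\ forall x, Phi x i * g (y x) = h (y x).
Hypothesis S_image : forall z, S z -> exists x, z =1 Phi x.

Lemma polyfun_rational f : polyfun f -> exists b h,
  polyfun h /\ forall x, f (Phi x) * g (y x) ^+ b = h (y x).
Proof.
elim=> [c|i|f1 f2 _ [b [h [ph hE]]] _ [b' [h' [ph' hE']]]
           |f1 f2 _ [b [h [ph hE]]] _ [b' [h' [ph' hE']]]].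
- by exists 0%N, (fun _ => c); split=> [|x]; [apply: pf_const|rewrite expr0 mulr1].
- by have [h [ph hE]] := Phi_rational i; exists 1%N, h; split.
- exists (b + b')%N, (fun z => h z * g z ^+ b' + h' z * g z ^+ b); split.
    by apply: pf_add; apply: pf_mul => //; apply: polyfun_exp.
  by move=> x; rewrite mulrDl {1}exprD mulrA hE addnC exprD mulrA hE'.
- exists (b + b')%N, (fun z => h z * h' z); split; first exact: pf_mul.
  by move=> x; rewrite exprD mulrACA hE hE'.
Qed.

(** The exponent of [g] and the degree bound are the same for all monomials [k]: a linear relation
    among the numerators [h'] is then one among the monomials, up to a common factor. *)
Lemma mono_rational D m b B G (f : nat -> pt K I -> K) (h : nat -> pt K J -> K) :
  (forall t, (t < m)%N -> bdeg B (h t)) -> bdeg G g ->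
  (forall t, (t < m)%N -> forall x, f t (Phi x) * g (y x) ^+ b = h t (y x)) ->
  forall k : midx D m, exists h',
    bdeg ((B + G * b) * D * m) h' /\
    forall x, mono f k (Phi x) * g (y x) ^+ (b * D * m) = h' (y x).
Proof.
move=> + bG; elim: m => [|m IH] bh hE.
  move=> k; exists (fun _ => 1); split=> [|x]; first by rewrite muln0; apply: bdeg_const.
  by rewrite muln0 expr0 mulr1.
case=> j k /=.
have [h' [bh' hE']] := IH (fun t l => bh t (leqW l)) (fun t l => hE t (leqW l)) k.
have lejD : (j <= D)%N := ltnW (ltn_ord j).
exists (fun z => h m z ^+ j * g z ^+ (b * (D - j)) * h' z); split.
  rewrite mulnS; apply: bdeg_mul bh'.
  apply: bdeg_leq (bdeg_mul (bdeg_exp j (bh m (ltnSn m))) (bdeg_exp _ bG)).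
  by rewrite mulnDl mulnA leq_add // leq_mul // leq_subr.
move=> x; rewrite mulnS exprD mulrACA hE' -hE // exprMn -exprM.
have -> : (b * D = b * j + b * (D - j))%N by rewrite -mulnDr subnKC.
by rewrite exprD !mulrA.
Qed.

(* Algebraically independent f_0, .., f_(m-1) would give D^m linearly independent
   monomials which, after clearing the denominator g, all lie in a space of
   dimension O(D^#|J|). *)
Lemma chain_bound : ~ has_chain (zclosure S) #|J|.+1.
Proof.
set m := #|J|.+1; case=> C [irrC subC].
have [f fP] := @chain_separators _ _ m C (fun t h => (irrC t h).1)
                  (fun t h => (subC t h).2).
pose P b t h := polyfun h /\ forall x, f t (Phi x) * g (y x) ^+ b = h (y x).
have [b exh] : exists b, forall t, (t < m)%N -> exists h, P b t h.
  apply: uniform_bound => [t b b' le_b [h [ph hE]]|t /fP[pft _ _]]; last first.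
    by have [b [h ?]] := polyfun_rational pft; exists b, h.
  exists (fun z => h z * g z ^+ (b' - b)); split.
    by apply: pf_mul => //; apply: polyfun_exp.
  by move=> x; rewrite -hE -mulrA -exprD subnKC.
have [h hP] : exists h, forall t, (t < m)%N -> P b t (h t).
  apply: (functional_choice (fun t h => (t < m)%N -> P b t h)) => t.
  have [/exh[h Ph]|] := boolP (t < m)%N.
    by exists h.
  by exists (fun _ => 0).
have [B hB] : exists B, forall t, (t < m)%N -> bdeg B (h t).
  apply: uniform_bound => [t B B'|t /hP[/polyfun_bdeg//]]; exact: bdeg_leq.
have [G gG] := polyfun_bdeg g_poly.
(* The numerators have degree at most [(B + G * b) * D * m], which is below [c0 * D]. Taking [D]
   larger than [c0 ^ #|J|] gives [(c0 * D) ^ #|J| < D ^ m], the count needed for dependence. *)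
pose c0 := ((B + G * b) * m).+1; pose D := (c0 ^ #|J|).+1.
have /fin_all_exists[F FP] :=
  @mono_rational D m b B G f h hB gG (fun t l => (hP t l).2).
have [|c [[k ck] cF]] := bdeg_dependent (fun k => (FP k).1).
  rewrite card_midx [X in (_ < X)%N]expnS.
  apply: (@leq_ltn_trans ((c0 * D) ^ #|J|)).
    have [-> //|J0] := posnP #|J|; rewrite leq_exp2r //.
    by rewrite /c0 mulSn mulnAC -[X in (X <= _)%N]add1n leq_add2r.
  by rewrite expnMn ltn_pmul2r // expn_gt0.
pose R x := \sum_k c k * mono f k x.
have pR : polyfun R.
  apply: polyfun_sum => k'; apply: pf_mul; first exact: pf_const.
  by apply: polyfun_mono => t /fP[].
(* The relation is known only after multiplication by a power of [g (y x)]. That power is a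
   polynomial function of [x], not identically zero, so it cancels. *)
have R0 x : R (Phi x) = 0.
  pose u x := g (y x) ^+ (b * D * m).
  apply: (@polyfun_domain _ _ charK (fun x => R (Phi x)) u) => {x}.
  - exact: polyfun_comp.
  - by apply: polyfun_exp; apply: polyfun_comp.
  - move=> x; rewrite -[RHS](cF (y x)) mulr_suml; apply: eq_bigr => k' _.
    by rewrite -mulrA (FP k').2.
  - by have [x gx] := g_neq0; exists x; rewrite expf_neq0.
have/eqP := ck; apply.
apply: (@chain_independent _ _ D m C f) => [t /irrC[]//|t /subC[]//|//|x Cx].
apply: (zclosure_zero pR) ((irrC m (leqnn m)).2 _ Cx) => z /S_image[w zw].
by rewrite -[RHS](R0 w); apply: pt_eq.
Qed.
End ChainBound.

(** Descending from [p] by excluded middle reaches the largest length at which a chain exists. *)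
Lemma krull_dim_exists (K : fieldType) (I : Type) (S : pt K I -> Prop) p :
  has_chain S 0 -> ~ has_chain S p.+1 -> exists m, krull_dim S m /\ (m <= p)%N.
Proof.
move=> ch0; elim: p => [|p IH] nch; first by exists 0%N.
have [chp|/IH[m [Sm lemp]]] := classic (has_chain S p.+1); first by exists p.+1.
by exists m; split=> //; apply: leqW.
Qed.

(** A single point is closed, cut out by the functions [z i - x i], and irreducible. *)
Lemma has_chain0 (K : fieldType) (I : Type) (S : pt K I -> Prop) x :
  S x -> has_chain (zclosure S) 0.
Proof.
move=> Sx; exists (fun _ z => z = x); split=> // t _; split; last first.
  by move=> _ -> Z _; apply.
split; [|by exists x|].
  exists (fun f => exists i, f = fun z => z i + - x i); split.
    by move=> _ [i ->]; apply: pf_add; [apply: pf_var|apply: pf_const].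
  move=> z; split=> [-> _ [i ->]|z0]; first exact: subrr.
  apply: functional_extensionality => i; apply/eqP.
  by rewrite -subr_eq0; apply/eqP/(z0 (fun z => z i + - x i)); exists i.
by move=> Z1 Z2 _ _ /(_ x erefl)[Zx|Zx]; [left|right] => _ ->.
Qed.

Lemma enum_pred (X : finType) (P : pred X) s : #|P| = s ->
  exists r : 'I_s -> X, injective r /\ forall x, P x <-> exists k, r k = x.
Proof.
move=> <-; exists (fun k => enum_val k); split; first exact: enum_val_inj.
move=> x; split=> [Px|[k <-]]; last exact: (enum_valP k).
by exists (enum_rank_in Px x); rewrite enum_rankK_in.
Qed.

(** * Determinants: bordered minors and a block Vandermonde matrix *)

Lemma det_bordered (K : fieldType) s (M M' : 'M[K]_s.+1) :
  (forall k l, (k, l) != (ord0, ord0) -> M k l = M' k l) ->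
  \det M - \det M' = (M ord0 ord0 - M' ord0 ord0) * \det (row' ord0 (col' ord0 M)).
Proof.
move=> MM'; rewrite (expand_det_row M ord0) (expand_det_row M' ord0) -sumrB.
have cE l : cofactor M ord0 l = cofactor M' ord0 l.
  congr (_ * \det _); by apply/matrixP => i j; rewrite !mxE MM'.
rewrite big_ord_recl big1 => [|l _]; last first.
  by rewrite cE MM' ?subrr //; apply/eqP => -[].
by rewrite addr0 -cE -mulrBl /cofactor expr0 mul1r.
Qed.

Lemma det_factor_eq0 (K : fieldType) s (A : 'M[K]_(s.+1, s)) (B : 'M[K]_(s, s.+1)) :
  \det (A *m B) = 0.
Proof.
apply/eqP; rewrite -[_ == _]negbK -unitfE -unitmxE -row_free_unit /row_free.
by rewrite neq_ltn (leq_ltn_trans (mxrankM_maxl _ _)) // ltnS rank_leq_col.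
Qed.

(* [r] lists the pairs (x, p) except the (x, 0) with x in X0; the root 0 stands
   in for the missing exponent 0. *)
Lemma vandermonde_unit (K : fieldType) (X : finType) (X0 : {set X}) D s
    (r : 'I_s -> X * 'I_D.+1) (tau : 'I_s -> K) :
  injective r -> injective tau -> (forall t, tau t != 0) ->
  (forall xp : X * 'I_D.+1,
     ~~ ((xp.1 \in X0) && (xp.2 == ord0)) <-> exists k, r k = xp) ->
  \matrix_(t < s, k < s) (((r k).1 == (r t).1)%:R * tau t ^+ (r k).2) \in unitmx.
Proof.
move=> r_inj tau_inj tau0 rP; rewrite -unitmx_tr -row_free_unit.
apply: inj_row_free => u u0; apply/rowP => k0; rewrite mxE.
(* The entries of the kernel vector over [x] are the coefficients of a polynomial [q] of degree at
   most [D]; it vanishes at every node whose row belongs to [x]. *)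
pose x := (r k0).1.
pose q : {poly K} := \sum_(k | (r k).1 == x) u 0 k *: 'X^((r k).2).
have qtau t : (r t).1 == x -> q.[tau t] = 0.
  move=> /eqP rt; have /matrixP/(_ 0 t) := u0; rewrite !mxE => <-.
  rewrite horner_sum [RHS](bigID (fun k => (r k).1 == x)) /=.
  rewrite [X in _ = _ + X]big1 ?addr0 => [|k /negbTE rk]; last first.
    by rewrite !mxE rt rk mul0r mulr0.
  by apply: eq_bigr => k rk; rewrite !mxE rt rk mul1r hornerZ hornerXn.
(* One root for each exponent [p]. Only the pair [(x, 0)] can be missing, so the value 0 is used at
   most once and the [D.+1] roots stay distinct. *)
pose rt p := if [pick t | r t == (x, p)] is Some t then tau t else 0.
have rt0 p : ~~ [exists t, r t == (x, p)] -> (x \in X0) && (p == ord0).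
  by apply: contraNT => /(rP (x, p))[t /eqP rt_]; apply/existsP; exists t.
have q0 : q = 0.
  apply: (@roots_geq_poly_eq0 _ q [seq rt p | p <- enum 'I_D.+1]).
  - apply/allP => _ /mapP[p _ ->]; apply/eqP; rewrite /rt.
    case: pickP => [t /eqP rtE|none]; first by rewrite qtau // rtE.
    have /rt0/andP[xX0 _] : ~~ [exists t, r t == (x, p)].
      by apply/existsPn => t; rewrite none.
    rewrite horner_sum big1 // => k /eqP rk; rewrite hornerZ hornerXn expr0n.
    have : ~~ (((r k).1 \in X0) && ((r k).2 == ord0)) by apply/rP; exists k.
    by rewrite rk xX0 -val_eqE /= => /negbTE ->; rewrite mulr0.
  - rewrite map_inj_uniq ?enum_uniq // => p p'; rewrite /rt.
    case: pickP => [t /eqP tE|none]; case: pickP => [t' /eqP tE'|none'].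
    + by move=> /tau_inj tt'; move: tE; rewrite tt' tE' => -[].
    + by move=> /eqP; rewrite (negbTE (tau0 _)).
    + by move=> /esym/eqP; rewrite (negbTE (tau0 _)).
    + have /rt0/andP[_ /eqP->] : ~~ [exists t, r t == (x, p)].
        by apply/existsPn => t; rewrite none.
      have /rt0/andP[_ /eqP->//] : ~~ [exists t, r t == (x, p')].
      by apply/existsPn => t; rewrite none'.
  - rewrite size_map size_enum_ord; apply/leq_sizeP => j ltj.
    rewrite coef_sum big1 // => k _; rewrite coefZ coefXn.
    case: eqP => [jE|]; rewrite ?mulr0 //.
    by move: (ltn_ord (r k).2); rewrite -jE ltnNge ltj.
have := congr1 (fun q : {poly K} => q`_(r k0).2) q0.
rewrite coef0 coef_sum (bigD1 k0) //= coefZ coefXn eqxx mulr1 big1 ?addr0 // => k.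
case/andP=> /eqP rk nk; rewrite coefZ coefXn; case: eqP => [rk2|]; rewrite ?mulr0 //.
case/eqP: nk; apply: r_inj; apply/eqP; rewrite [r k]surjective_pairing.
by rewrite [r k0]surjective_pairing xpair_eqE rk eqxx -val_eqE /= rk2 eqxx.
Qed.

(** * The flattening *)

Section Flattening.
Variables (K : fieldType) (A B : finType) (s d1 d2 : nat).
Hypothesis charK : [pchar K] =i pred0.
Variables (A0 : {set A}) (B0 : {set B}).

(* A point of [params] consists of s triples (a_t, b_t, c_t) of vectors, and
   [tensor] gives the coordinates of the sum of the a_t (x) b_t (x) c_t^(d1+d2). *)
Definition params := ('I_s * (A + B + bool))%type.
Implicit Types (x : pt K params) (t : 'I_s) (r : A * 'I_d1.+1) (c : B * 'I_d2.+1).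

Definition tidx := (A * B * 'I_(d1 + d2).+1)%type.
Implicit Types (m : tidx).

Definition pA x t i := x (t, inl (inl i)).
Definition pB x t j := x (t, inl (inr j)).
Definition pC x t b := x (t, inr b).

Definition term x t m : K :=
  pA x t m.1.1 * pB x t m.1.2 *
  (pC x t false ^+ (d1 + d2 - m.2) * pC x t true ^+ m.2).

Definition tensor x m : K := \sum_t term x t m.

Definition flat r c : tidx := ((r.1, c.1), inord (r.2 + c.2)).

Definition vA x t r := pA x t r.1 * (pC x t false ^+ (d1 - r.2) * pC x t true ^+ r.2).
Definition vB x t c := pB x t c.1 * (pC x t false ^+ (d2 - c.2) * pC x t true ^+ c.2).

Lemma term_flat x t r c : term x t (flat r c) = vA x t r * vB x t c.
Proof.
rewrite /term /vA /vB /= inordK; last first.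
  by rewrite ltnS leq_add // -ltnS.
have [l1 l2] : (r.2 <= d1)%N /\ (c.2 <= d2)%N by split; rewrite -ltnS.
rewrite [RHS]mulrACA; congr (_ * _); rewrite [RHS]mulrACA -!exprD.
by congr (_ ^+ _ * _); lia.
Qed.

Lemma tensor_poly m : polyfun (fun x => tensor x m).
Proof.
apply: polyfun_sum => t; apply: pf_mul; first by apply: pf_mul; apply: pf_var.
by apply: pf_mul; apply: polyfun_exp; apply: pf_var.
Qed.

Definition lost m := [&& m.1.1 \in A0, m.1.2 \in B0 & m.2 == ord0].
Definition kept := {m : tidx | ~~ lost m}.

Definition proj x : pt K kept := fun k => tensor x (val k).
(** Filling lost coordinates with 0 puts a 0 in the corner of the bordered minor, making it a
    function of the kept coordinates alone. *)
Definition ext0 (z : pt K kept) m : K := if insub m is Some k then z k else 0.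

Lemma ext0_proj x m : ~~ lost m -> ext0 (proj x) m = tensor x m.
Proof. by move=> km; rewrite /ext0 insubT. Qed.

Lemma ext0_lost z m : lost m -> ext0 z m = 0.
Proof. by move=> lm; rewrite /ext0 insubF // lm. Qed.

Lemma ext0_poly m : polyfun (fun z => ext0 z m).
Proof. by rewrite /ext0; case: insub => [k|]; [apply: pf_var|apply: pf_const]. Qed.

Variables (rA : 'I_s -> A * 'I_d1.+1) (rB : 'I_s -> B * 'I_d2.+1).
Hypotheses (rA_inj : injective rA) (rB_inj : injective rB).
Hypothesis rAP :
  forall r, ~~ ((r.1 \in A0) && (r.2 == ord0)) <-> exists k, rA k = r.
Hypothesis rBP :
  forall c, ~~ ((c.1 \in B0) && (c.2 == ord0)) <-> exists k, rB k = c.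

(** The two exponents add up to 0 only if both are 0, so lost coordinates appear only where a row
    and a column left out by [rA] and [rB] meet. *)
Lemma lost_flat r c : lost (flat r c) ->
  [/\ r.1 \in A0, r.2 = ord0, c.1 \in B0 & c.2 = ord0].
Proof.
case/and3P=> /= rA0 cB0; rewrite -val_eqE /= inordK; last first.
  by rewrite ltnS leq_add // -ltnS.
by rewrite addn_eq0 => /andP[/eqP r2 /eqP c2]; split=> //; apply: val_inj.
Qed.

Lemma kept_row k c : ~~ lost (flat (rA k) c).
Proof.
apply/negP => /lost_flat[rA0 r0 _ _].
by have /rAP : exists k', rA k' = rA k by [exists k]; rewrite rA0 r0 eqxx.
Qed.

Lemma kept_col r l : ~~ lost (flat r (rB l)).
Proof.
apply/negP => /lost_flat[_ _ cB0 c0].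
by have /rBP : exists l', rB l' = rB l by [exists l]; rewrite cB0 c0 eqxx.
Qed.

Definition mxA x := \matrix_(t < s, k < s) vA x t (rA k).
Definition mxB x := \matrix_(t < s, l < s) vB x t (rB l).

Definition pivot (z : pt K kept) :=
  \det (\matrix_(k < s, l < s) ext0 z (flat (rA k) (rB l))).

Lemma pivot_poly : polyfun pivot.
Proof.
apply: polyfun_det => k l.
by apply: polyfun_ext (ext0_poly (flat (rA k) (rB l))) => z; rewrite mxE.
Qed.

Lemma pivot_proj x : pivot (proj x) = \det (mxA x) * \det (mxB x).
Proof.
rewrite -[\det (mxA x)]det_tr -det_mulmx; congr (\det _).
apply/matrixP => k l; rewrite !mxE ext0_proj ?kept_row //.
by apply: eq_bigr => t _; rewrite !mxE term_flat.
Qed.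

(* The lost coordinate is the corner of an (s+1)-minor of a flattening of rank
   at most s, and occurs nowhere else in that minor. *)
Lemma tensor_rational m : exists h, polyfun h /\
  forall x, tensor x m * pivot (proj x) = h (proj x).
Proof.
have [/and3P[mA mB m0]|km] := boolP (lost m); last first.
  exists (fun z => ext0 z m * pivot z); split.
    by apply: pf_mul; [apply: ext0_poly|apply: pivot_poly].
  by move=> x; rewrite ext0_proj.
pose R (k : 'I_s.+1) := if unlift ord0 k is Some k' then rA k' else (m.1.1, ord0).
pose C (l : 'I_s.+1) := if unlift ord0 l is Some l' then rB l' else (m.1.2, ord0).
have Rl k : R (lift ord0 k) = rA k by rewrite /R liftK.
have Cl l : C (lift ord0 l) = rB l by rewrite /C liftK.
have R0 : R ord0 = (m.1.1, ord0) by rewrite /R unlift_none.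
have C0 : C ord0 = (m.1.2, ord0) by rewrite /C unlift_none.
have mE : flat (R ord0) (C ord0) = m.
  rewrite R0 C0 /flat /= (surjective_pairing m) (surjective_pairing m.1).
  by congr (_, _, _); rewrite (eqP m0); apply: val_inj; rewrite /= inordK.
(* The full bordered minor is 0, and replacing its corner by 0 subtracts corner times pivot; hence
   the sign. *)
exists (fun z => -1 * \det (\matrix_(k, l) ext0 z (flat (R k) (C l)))); split.
  apply: pf_mul; first exact: pf_const.
  apply: polyfun_det => k l.
  by apply: polyfun_ext (ext0_poly (flat (R k) (C l))) => z; rewrite mxE.
move=> x; set M' := \matrix_(_, _) _.
pose M := \matrix_(k, l) tensor x (flat (R k) (C l)).
have detM : \det M = 0.
  suff -> : M = (\matrix_(k, t) vA x t (R k)) *m (\matrix_(t, l) vB x t (C l)).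
    exact: det_factor_eq0.
  apply/matrixP => k l; rewrite !mxE; apply: eq_bigr => t _.
  by rewrite !mxE term_flat.
have := @det_bordered _ _ M M'; rewrite detM sub0r mulN1r => ->; last first.
  move=> k l; rewrite !mxE => kl0; rewrite ext0_proj //.
  case: (unliftP ord0 k) kl0 => [k' ->|->]; first by rewrite Rl kept_row.
  by case: (unliftP ord0 l) => [l' ->|->]; [rewrite Cl kept_col|rewrite eqxx].
rewrite !mxE mE ext0_lost ?subr0; last by apply/and3P.
congr (_ * \det _); apply/matrixP => k l.
by rewrite !mxE Rl Cl ext0_proj ?kept_row.
Qed.

(** The vectors [a_t] and [b_t] are the basis vectors named by [rA t] and [rB t], and [c_t] is
    [(1, t+1)]. This makes [mxA] and [mxB] block Vandermonde matrices with distinct nonzero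
    nodes. *)
Definition generic : pt K params := fun q =>
  match q.2 with
  | inl (inl i) => (i == (rA q.1).1)%:R
  | inl (inr j) => (j == (rB q.1).1)%:R
  | inr b => if b then q.1.+1%:R else 1
  end.

Lemma generic_unit : mxA generic \in unitmx /\ mxB generic \in unitmx.
Proof.
have tau_inj : injective (fun t : 'I_s => t.+1%:R : K).
  by move=> t t' /(natr_inj charK)[/val_inj].
have tau0 (t : 'I_s) : t.+1%:R != 0 :> K by rewrite (pcharf0P _).1.
split.
  suff -> : mxA generic = \matrix_(t < s, k < s)
      (((rA k).1 == (rA t).1)%:R * t.+1%:R ^+ (rA k).2).
    exact: (vandermonde_unit rA_inj tau_inj tau0 rAP).
  by apply/matrixP => t k; rewrite !mxE /vA /pA /pC /generic /= expr1n mul1r.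
suff -> : mxB generic = \matrix_(t < s, k < s)
    (((rB k).1 == (rB t).1)%:R * t.+1%:R ^+ (rB k).2).
  exact: (vandermonde_unit rB_inj tau_inj tau0 rBP).
by apply/matrixP => t k; rewrite !mxE /vB /pB /pC /generic /= expr1n mul1r.
Qed.

(** The pivot block of the weighted sum is the diagonal matrix of [lam] between two invertible
    matrices. This supplies independent points, so the secant union is nonempty. *)
Lemma generic_free (lam : 'I_s -> K) :
  (forall m, \sum_t lam t * term generic t m = 0) -> forall t, lam t = 0.
Proof.
move=> lam0 t; have [uA uB] := generic_unit.
have : (mxA generic)^T *m diag_mx (\row_t lam t) *m mxB generic = 0.
  apply/matrixP => k l; rewrite mul_mx_diag !mxE -[RHS](lam0 (flat (rA k) (rB l))).
  apply: eq_bigr => t2 _; rewrite !mxE term_flat. 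
  by rewrite [RHS]mulrA [lam _ * _]mulrC.
move/(canRL (mulmxK uB)); rewrite mul0mx.
rewrite -unitmx_tr in uA; move/(canRL (mulKmx uA)); rewrite mulmx0.
by move/matrixP/(_ t t); rewrite !mxE eqxx mulr1n.
Qed.

Lemma tensor_chain_bound (I : Type) (S : pt K I -> Prop) (pi : I -> tidx) :
  (forall z, S z -> exists x, forall i, z i = tensor x (pi i)) ->
  ~ has_chain (zclosure S) #|{: kept}|.+1.
Proof.
move=> Sx; pose Phi x i := tensor x (pi i).
apply: (@chain_bound K I params _ S Phi proj pivot) => //.
- by move=> i; apply: tensor_poly.
- by move=> k; apply: tensor_poly.
- exact: pivot_poly.
- exists generic; rewrite pivot_proj mulf_neq0 // -unitfE -unitmxE.
    exact: generic_unit.1.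
  exact: generic_unit.2.
- by move=> i; apply: tensor_rational.
Qed.

Lemma card_kept : (#|{: kept}| + #|A0| * #|B0| = #|A| * #|B| * (d1 + d2).+1)%N.
Proof.
rewrite card_sig.
have -> : (#|A0| * #|B0| = #|lost|)%N.
  rewrite -cardsX -(cardsE lost) -(muln1 #|_|) -(cards1 (ord0 : 'I_(d1 + d2).+1)) -cardsX.
  by apply: eq_card => -[[i j] p]; rewrite !inE -andbA.
by rewrite addnC cardC !card_prod card_ord.
Qed.

End Flattening.

Lemma card_ord_ltn n h : (h <= n)%N -> #|[pred i : 'I_n | (i < h)%N]| = h.
Proof.
move=> le_hn; rewrite -sum1_card -(big_ord_widen n (fun _ => 1%N)) //.
by rewrite sum1_card card_ord.
Qed.

Lemma card_rows (X : finType) (X0 : {set X}) D :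
  (#|[pred r : X * 'I_D.+1 | ~~ ((r.1 \in X0) && (r.2 == ord0))]| + #|X0|
   = #|X| * D.+1)%N.
Proof.
rewrite -[#|X0|]muln1 -(cards1 (ord0 : 'I_D.+1)) -cardsX addnC.
have <- : #|{: X * 'I_D.+1}| = (#|X| * D.+1)%N by rewrite card_prod card_ord.
rewrite -(cardC [in setX X0 [set ord0]]).
by congr (_ + _)%N; apply: eq_card => -[x p]; rewrite !inE.
Qed.

Lemma prod_binary (K : fieldType) d (c : 'I_2 -> K) (f : 'I_d -> 'I_2) :
  let k := #|[pred t | f t != ord0]| in
  \prod_t c (f t) = c ord0 ^+ (d - k) * c ord_max ^+ k.
Proof.
move=> k; rewrite (bigID (fun t => f t == ord0)) /=; congr (_ * _).
  rewrite (eq_bigr (fun _ => c ord0)) => [|t /eqP->//]; rewrite prodr_const.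
  congr (_ ^+ _); rewrite -[X in (X - _)%N]card_ord -(cardC [pred t | f t == ord0]) addnK.
  exact: eq_card.
rewrite (eq_bigr (fun _ => c ord_max)) => [|t ft]; first by rewrite prodr_const.
by congr c; apply: val_inj; case: (f t) ft => -[|[|]].
Qed.

(** * The Segre-Veronese variety *)

Definition o0 : 'I_3 := @Ordinal 3 0 isT.
Definition o1 : 'I_3 := @Ordinal 3 1 isT.
Definition o2 : 'I_3 := @Ordinal 3 2 isT.

Lemma big_ord3 (T : Type) (id : T) (op : Monoid.law id) (F : 'I_3 -> T) :
  \big[op/id]_i F i = op (op (F o0) (F o1)) (F o2).
Proof.
have -> : o0 = ord0 by apply: val_inj.
have -> : o1 = lift ord0 ord0 by apply: val_inj.
have -> : o2 = lift ord0 (lift ord0 ord0) by apply: val_inj.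
by rewrite !big_ord_recl big_ord0 Monoid.mulm1 Monoid.mulmA.
Qed.

Section SegreVeroneseTriple.
Variables (K : fieldType) (n1 n2 d1 d2 d s : nat).
Hypothesis charK : [pchar K] =i pred0.
Hypothesis dE : (d1 + d2 = d)%N.

Notation nv := (tri n1 n2 1).
Notation dv := (tri 1 1 d).
Notation idx := (SVidx nv dv).
Notation A := 'I_n1.+1.
Notation B := 'I_n2.+1.

Lemma ord3P (P : 'I_3 -> Prop) : P o0 -> P o1 -> P o2 -> forall i, P i.
Proof.
by move=> P0 P1 P2 [[|[|[|//]]] lti]; [move: P0|move: P1|move: P2];
  congr P; apply: val_inj.
Qed.

Definition part0 (j : idx) : A := (j o0 : {ffun 'I_1 -> A}) ord0.
Definition part1 (j : idx) : B := (j o1 : {ffun 'I_1 -> B}) ord0.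
Definition part2 (j : idx) : nat :=
  #|[pred t | (j o2 : {ffun 'I_d -> 'I_2}) t != ord0]|.

Lemma part2_le j : (part2 j <= d)%N.
Proof. by rewrite -[X in (_ <= X)%N]card_ord max_card. Qed.

(* [sv_point u j] depends only on [monomial j]. *)
Definition monomial (j : idx) : tidx A B d1 d2 := (part0 j, part1 j, inord (part2 j)).

Lemma sv_pointE (u : forall i : 'I_3, 'I_(nv i).+1 -> K) j :
  sv_point u j = u o0 (part0 j) * u o1 (part1 j) *
    (u o2 (ord0 : 'I_2) ^+ (d - part2 j) * u o2 (ord_max : 'I_2) ^+ part2 j).
Proof.
rewrite -(prod_binary (u o2) (j o2)) /sv_point big_ord3.
congr (_ * _ * _); first exact: (@big_ord1 _ _ _ (fun t : 'I_1 => u o0 (j o0 t))).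
exact: (@big_ord1 _ _ _ (fun t : 'I_1 => u o1 (j o1 t))).
Qed.

Lemma secant_tensor (z : pt K idx) : secant_union s z ->
  exists x : pt K (params A B s), forall j, z j = tensor x (monomial j).
Proof.
case=> v [/fin_all_exists[u uP] _ [lam ->]].
(* The coefficients [lam] are absorbed into the first vectors, in which each term is linear. *)
pose x : pt K (params A B s) := fun q => match q.2 with
  | inl (inl i) => lam q.1 * u q.1 o0 i
  | inl (inr i) => u q.1 o1 i
  | inr b => u q.1 o2 (if b then ord_max : 'I_2 else ord0 : 'I_2)
  end.
exists x => j; apply: eq_bigr => t _; have [_ ->] := uP t.
rewrite sv_pointE /term /pA /pB /pC /= inordK ?dE ?ltnS ?part2_le //.
by rewrite !mulrA.
Qed.

Lemma monomial_surj m : exists j, monomial j = m.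
Proof.
case: m => [[i1 i2] p].
(* In the last factor, the word with 1 in its first [p] places and 0 afterwards represents the
   exponent [p]. *)
pose j : idx := [ffun i : 'I_3 => [ffun r : 'I_(dv i) => inord (
  if i == o0 then i1 : nat else if i == o1 then i2 : nat else (r < p)%N : nat)
  : 'I_(nv i).+1]].
have le_pd : (p <= d)%N by rewrite -dE -ltnS.
exists j; congr (_, _, _).
- by rewrite /part0 !ffunE /= inord_val.
- by rewrite /part1 !ffunE /= inord_val.
apply: val_inj; rewrite /= inordK ?dE ?ltnS ?part2_le //.
rewrite -[RHS](card_ord_ltn le_pd); apply: eq_card => t; rewrite !inE !ffunE /=.
by rewrite -val_eqE /= inordK; case: (t < p)%N.
Qed.

Variables (A0 : {set A}) (B0 : {set B}).
Hypothesis cardA0 : (s + #|A0| = n1.+1 * d1.+1)%N.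
Hypothesis cardB0 : (s + #|B0| = n2.+1 * d2.+1)%N.

Lemma sigma_krull_dim : exists m,
  krull_dim (sigma_cone (K := K) (nv := nv) (dv := dv) s) m /\
  (m + #|A0| * #|B0| <= n1.+1 * n2.+1 * d.+1)%N.
Proof.
have [|rA [rA_inj rAP]] := @enum_pred (A * 'I_d1.+1)%type
    [pred r | ~~ ((r.1 \in A0) && (r.2 == ord0))] s.
  by apply/eqP; rewrite -(eqn_add2r #|A0|) card_rows card_ord cardA0.
have [|rB [rB_inj rBP]] := @enum_pred (B * 'I_d2.+1)%type
    [pred r | ~~ ((r.1 \in B0) && (r.2 == ord0))] s.
  by apply/eqP; rewrite -(eqn_add2r #|B0|) card_rows card_ord cardB0.
have nch := tensor_chain_bound charK rA_inj rB_inj rAP rBP secant_tensor.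
pose x := generic K rA rB.
(* The type of [c] depends on [i]; passing through [nat] and [inord] avoids casts and is exact in
   each factor. *)
pose u t (i : 'I_3) (c : 'I_(nv i).+1) : K :=
  if i == o0 then pA x t (inord c) else
  if i == o1 then pB x t (inord c) else pC x t (c != 0%N :> nat).
have uE t j : sv_point (u t) j = term x t (monomial j).
  rewrite sv_pointE /term /u /= !inord_val inordK ?dE ?ltnS ?part2_le //.
have ch0 : has_chain (sigma_cone (K := K) (nv := nv) (dv := dv) s) 0.
  apply: (@has_chain0 _ _ _ (fun j => \sum_t 1 * sv_point (u t) j)).
  exists (fun t => sv_point (u t)); split; last by exists (fun _ => 1).
    move=> t; exists (u t); split=> //; apply: ord3P.
    - exists (rA t).1; rewrite /u /= inord_val /pA /x /generic /= eqxx; exact: oner_neq0.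
    - exists (rB t).1; rewrite /u /= inord_val /pB /x /generic /= eqxx; exact: oner_neq0.
    - exists (ord0 : 'I_2); exact: oner_neq0.
  move=> lam lam0; apply: (generic_free charK rA_inj rB_inj rAP rBP) => m.
  have [j <-] := monomial_surj m; rewrite -[RHS](lam0 j).
  by apply: eq_bigr => t _; rewrite uE.
have [m [km le_m]] := krull_dim_exists ch0 nch; exists m; split=> //.
have := card_kept d1 d2 A0 B0; rewrite !card_ord -dE => <-.
by rewrite leq_add2r.
Qed.

End SegreVeroneseTriple.

(** * Numerical comparison and conclusion *)

Lemma ord_subset_of_card n h : (h <= n)%N -> exists X : {set 'I_n}, #|X| = h.
Proof. by exists [set i : 'I_n | (i < h)%N]; rewrite cardsE card_ord_ltn. Qed.

(** The right side minus the left side equals [(p - h0) * (q - h1)], which is positive. *)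
Lemma dim_lt_expected p q u v s h0 h1 :
  (s + h0 = p * u.+1)%N -> (s + h1 = q * v.+1)%N -> (h0 < p)%N -> (h1 < q)%N ->
  (p * q * (u + v).+1 < s * (p + q) + h0 * h1)%N.
Proof.
move=> sp sq lt_p lt_q.
have gap : (0 < (p - h0) * (q - h1))%N by rewrite muln_gt0 !subn_gt0 lt_p.
have E : (q * (s + h0) + p * (s + h1) = q * (p * u.+1) + p * (q * v.+1))%N.
  by rewrite sp sq.
have [x pE] : exists x, p = (h0 + x)%N by exists (p - h0)%N; lia.
have [y qE] : exists y, q = (h1 + y)%N by exists (q - h1)%N; lia.
by move: gap E; rewrite pE qE !addKn => {sp sq lt_p lt_q pE qE}; lia.
Qed.

Theorem mainTheorem6 (K : closedFieldType) (charK : [pchar K]%R =i pred0)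
  (n a d e s : nat) :
  (1 <= n)%N -> (2 <= d)%N -> (1 <= e)%N -> (e <= d - 1)%N -> (1 <= s)%N ->
  (maxn ((n + 1) * (d - e) + 1) ((n + a + 1) * e + 1) <= s)%N ->
  (Posz ((n + 1) * (d - e + 1)) - Posz s <= Posz n)%R ->
  (0 < Posz ((n + 1) * (d - e + 1)) - Posz s)%R ->
  (Posz ((n + a + 1) * (e + 1)) - Posz s <= Posz (n + a))%R ->
  (0 < Posz ((n + a + 1) * (e + 1)) - Posz s)%R ->
  sv_defective K (tri n (n + a) 1) (tri 1 1 d) s.
Proof.
move=> _ d2 e1 le_ed _ _ hA hA0 hB hB0.
have dE : (d - e + e = d)%N by lia.
pose h0 := ((n + 1) * (d - e + 1) - s)%N; pose h1 := ((n + a + 1) * (e + 1) - s)%N.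
have [h0_gt0 h0_le] : (0 < h0)%N /\ (h0 <= n)%N by rewrite /h0; lia.
have [h1_gt0 h1_le] : (0 < h1)%N /\ (h1 <= n + a)%N by rewrite /h1; lia.
have [A0 cA0] := ord_subset_of_card (leqW h0_le).
have [B0 cB0] := ord_subset_of_card (leqW h1_le).
have sA : (s + h0 = n.+1 * (d - e).+1)%N by rewrite /h0; lia.
have sB : (s + h1 = (n + a).+1 * e.+1)%N by rewrite /h1; lia.
have [||m [km]] := @sigma_krull_dim K n (n + a) (d - e) e d s charK dE A0 B0.
- by rewrite cA0.
- by rewrite cB0.
rewrite cA0 cB0 => le_m; exists m; split=> //.
have -> : Dsum (tri n (n + a) 1) = (n + (n + a) + 1)%N by rewrite /Dsum big_ord3.
have -> : Ncount (tri n (n + a) 1) (tri 1 1 d) = (n.+1 * (n + a).+1 * d.+1)%N.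
  by rewrite /Ncount big_ord3 /tri /= !bin1 binSn !addn1.
have hh : (0 < h0 * h1)%N by rewrite muln_gt0 h0_gt0.
(* The bound by [Ncount] follows from [h0 * h1 > 0]; the bound by [s * (D + 1)] uses
   [D + 1 = (n + 1) + (n + a + 1)]. *)
rewrite ltrD2r ltz_nat leq_min; apply/andP; split; last first.
  by apply: leq_trans le_m; rewrite -addn1 leq_add2l.
have := @dim_lt_expected n.+1 (n + a).+1 (d - e) e s h0 h1 sA sB h0_le h1_le.
rewrite dE => /(leq_ltn_trans le_m); rewrite ltn_add2r.
by rewrite -(addn1 (n + (n + a) + 1)) addSn !addnS !addn0.
Qed.
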